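(* Let $P$ be a polytope with $\dim(P)\geqslant 1$. Then $\mathrm{rc}(P)$ is the smallest integer $r\geqslant 1$ such that the face lattice $\mathcal{L}(P)$ embeds into the Boolean lattice $2^{[r]}$.
   Context: $\mathcal{L}(P)$ is the set of all faces of $P$ (including $\varnothing$ and $P$) partially ordered by inclusion; $2^{[r]}$ is the set of all subsets of $\{1,\dots,r\}$ ordered by inclusion. An embedding of a poset $(S,\leqslant)$ into a poset $(T,\sqsubseteq)$ is a map $f$ with $u\leqslant v$ iff $f(u)\sqsubseteq f(v)$. For a real matrix $M$, a rectangle covering is a set of rectangles $I\times J$ (row index set times column index set), each contained in $\mathrm{supp}(M)=\{(i,j):M_{i,j}\neq0\}$, whose union is $\mathrm{supp}(M)$; $\mathrm{rc}(M)$ is the minimum size of one. $\mathrm{rc}(P)$ is $\mathrm{rc}$ of the facet vs.\ vertex non-incidence matrix of $P$ (rows facets, columns vertices, entry $1$ iff the facet does not contain the vertex). *)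

(* Defs.v *)
From HB Require Import structures.
From mathcomp Require Import all_boot all_order all_algebra.
From mathcomp Require Import boolp classical_sets functions cardinality reals.

Set Implicit Arguments.
Unset Strict Implicit.
Unset Printing Implicit Defensive.

Import Order.TTheory GRing.Theory Num.Theory.

Local Open Scope classical_set_scope.
Local Open Scope card_scope.
Local Open Scope ring_scope.

Definition is_least (A : set nat) (r : nat) : Prop := A r /\ lbound A r.

Definition order_embedding (S T : Type) (D : set S) (leS : S -> S -> Prop)
    (leT : T -> T -> Prop) (f : S -> T) : Prop :=
  forall u v, D u -> D v -> (leS u v <-> leT (f u) (f v)).

Section RectangleCovering.
Variables (R : realType) (I J : Type).
Implicit Types (M : I -> J -> R) (Q : set (I * J)) (C : set (set (I * J))).

Definition supp M : set (I * J) := [set ij | M ij.1 ij.2 != 0].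

Definition rectangle Q : Prop :=
  exists (A : set I) (B : set J), Q = A `*` B.

Definition rectangle_covering M C : Prop :=
  (forall Q, C Q -> rectangle Q /\ Q `<=` supp M) /\
  \bigcup_(Q in C) Q = supp M.

(* The default value 0 is returned when M has no finite rectangle covering,
   which cannot happen when I and J are finite. *)
Definition rc M : nat :=
  xget 0%N (is_least [set r | exists C, rectangle_covering M C /\ C #= `I_r]).

End RectangleCovering.

Section Polytope.
Variables (R : realType) (n : nat).
Implicit Types (P F A : set 'rV[R]_n) (U : {vspace 'rV[R]_n}).

Definition dot (c x : 'rV[R]_n) : R := \sum_i c 0 i * x 0 i.

Definition convex_hull (m : nat) (p : 'I_m -> 'rV[R]_n) : set 'rV[R]_n :=
  [set x | exists l : 'I_m -> R,
    [/\ forall i, 0 <= l i, \sum_i l i = 1 & x = \sum_i l i *: p i]].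

Definition polytope P : Prop :=
  exists (m : nat) (p : 'I_m -> 'rV[R]_n), P = convex_hull p.

(* The improper faces are included: c = 0 with b = 0 gives P, and c = 0 with
   b = 1 gives the empty face. *)
Definition face P F : Prop :=
  exists (c : 'rV[R]_n) (b : R),
    (forall x, P x -> dot c x <= b) /\ F = P `&` [set x | dot c x = b].

Definition faces P : set (set 'rV[R]_n) := [set F | face P F].

(* For nonempty A, the linear subspace parallel to the affine hull of A. *)
Definition is_direction A U : Prop :=
  (forall x y, A x -> A y -> x - y \in U) /\
  (forall W : {vspace 'rV[R]_n},
     (forall x y, A x -> A y -> x - y \in W) -> (U <= W)%VS).

Lemma direction_exists A : exists U, is_direction A U.
Proof.
pose good U := forall x y, A x -> A y -> x - y \in U.
have ex : exists d, `[< exists2 U, good U & \dim U = d >].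
  by exists (\dim (fullv : {vspace 'rV[R]_n})); apply/asboolP; exists fullv => // x y _ _; rewrite memvf.
case: (ex_minnP ex) => d /asboolP[U gU dU] dmin.
exists U; split=> // W gW.
have gUW : good (U :&: W)%VS by move=> x y Ax Ay; rewrite memv_cap gU ?gW.
have le_d : (\dim U <= \dim (U :&: W))%N.
  by rewrite dU; apply: dmin; apply/asboolP; exists (U :&: W)%VS.
by apply/capv_idPl/eqP; rewrite eqEdim capvSl le_d.
Qed.

Lemma direction_unique A U V : is_direction A U -> is_direction A V -> U = V.
Proof.
move=> [gU mU] [gV mV]; apply/eqP.
by rewrite (eqEsubv U V) mU // mV.
Qed.

Definition direction A : {vspace 'rV[R]_n} := xget 0%VS (is_direction A).

(* Dimension of the affine hull, with value -1 on the empty set. *)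
Definition affdim A : int :=
  if `[< A = set0 >] then - 1 else (\dim (direction A))%:Z.

Definition facets P : set (set 'rV[R]_n) :=
  [set F | face P F /\ affdim F = affdim P - 1].

(* A vertex is identified with the unique point of a zero-dimensional face. *)
Definition vertices P : set 'rV[R]_n := [set v | face P [set v]].

Definition nonincidence P (F : facets P) (v : vertices P) : R :=
  (\val v \notin \val F)%:R.

Definition rc_polytope P : nat := rc (@nonincidence P).

(* The subsets of {1, ..., r} are represented by {set 'I_r}. *)
Definition face_lattice_embeds P (r : nat) : Prop :=
  exists f : set 'rV[R]_n -> {set 'I_r},
    order_embedding (faces P) subset (fun S T : {set 'I_r} => S \subset T) f.

End Polytope.

(* Main.v *)
Require Import Defs.
From HB Require Import structures.
From mathcomp Require Import all_boot all_order all_algebra.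
From mathcomp Require Import boolp classical_sets functions cardinality reals.

Import Order.TTheory GRing.Theory Num.Theory.

Local Open Scope classical_set_scope.
Local Open Scope ring_scope.

(** A face [F] not contained in a face [G] has a vertex lying outside some facet
    that contains [G]: a face containing [G] and avoiding a point [x] of the
    polytope, if maximal, must be a facet, since otherwise its supporting
    hyperplane could be rotated around the affine hull of the face and [x];
    minimising the functional of the facet over [F] then yields the vertex.
    So [F] is included in [G] exactly when no pair (facet containing [G], vertex
    of [F]) is non-incident.  A covering by rectangles [I_k * J_k] gives the
    embedding [F |-> {k | F has a vertex in J_k}], and an embedding [f] gives the
    covering by the rectangles [{H | k \notin f H} * {v | k \in f {v}}]. *)

(** * Linear functionals on row vectors *)

Section Geometry.
Variables (R : realType) (n : nat).
Implicit Types (c d x y v : 'rV[R]_n) (a b e : R) (A F G H P : set 'rV[R]_n).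

Lemma dot_is_linear c : linear (dot c : 'rV[R]_n -> R^o).
Proof.
move=> a x y; rewrite /dot /GRing.scale /= mulr_sumr -big_split /=.
by apply: eq_bigr => i _; rewrite !mxE mulrDr mulrCA.
Qed.

HB.instance Definition _ c := GRing.isLinear.Build R 'rV[R]_n R^o *:%R (dot c)
  (dot_is_linear c).

Lemma dotC c x : dot c x = dot x c.
Proof. by apply: eq_bigr => i _; rewrite mulrC. Qed.

Lemma dotBr c x y : dot c (x - y) = dot c x - dot c y.
Proof. exact: (linearB (dot c)). Qed.

Lemma dotDl c d x : dot (c + d) x = dot c x + dot d x.
Proof. by rewrite !(dotC _ x); exact: (linearD (dot x)). Qed.

Lemma dotNl c x : dot (- c) x = - dot c x.
Proof. by rewrite !(dotC _ x); exact: (linearN (dot x)). Qed.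

Lemma dotZl a c x : dot (a *: c) x = a * dot c x.
Proof. by rewrite !(dotC _ x); exact: (linearZ_LR (dot x)). Qed.

Lemma dot0l x : dot 0 x = 0.
Proof. by rewrite dotC; exact: (linear0 (dot x)). Qed.

Lemma dot_combination m (l : 'I_m -> R) (p : 'I_m -> 'rV[R]_n) c :
  dot c (\sum_i l i *: p i) = \sum_i l i * dot c (p i).
Proof.
rewrite (linear_sum (dot c)); apply: eq_bigr => i _.
exact: (linearZ_LR (dot c)).
Qed.

Lemma dot_delta x i : dot (delta_mx 0 i) x = x 0 i.
Proof.
rewrite /dot (bigD1 i) //= mxE !eqxx mul1r big1 ?addr0 // => j /negbTE ji.
by rewrite mxE ji andbF mul0r.
Qed.

(** The residual [u - projv V u] vanishes on [V] but not at [v]. A coordinate where the residual of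
    [v] is nonzero gives the functional, and [c] lists its values on the unit vectors. *)
Lemma separating_functional (V : {vspace 'rV[R]_n}) v : v \notin V ->
  exists c, (forall u, u \in V -> dot c u = 0) /\ dot c v != 0.
Proof.
move=> vV; have /rV0Pn[k wk] : v - projv V v != 0.
  by apply: contraNneq vV => /subr0_eq ->; exact: memv_proj.
pose f u := (u - projv V u) 0 k.
pose c := \row_j f (delta_mx 0 j).
have cf u : dot c u = f u.
  rewrite /f {2 3}(row_sum_delta u) linear_sum -sumrB summxE.
  apply: eq_bigr => j _; rewrite linearZ -scalerBr [in RHS]mxE.
  by rewrite [c 0 j]mxE mulrC.
exists c; split=> [u uV|]; last by rewrite cf.
by rewrite cf /f projv_id // subrr mxE.
Qed.

(** * Directions and dimension of affine hulls *)

Lemma direction_spec A : is_direction A (direction A).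
Proof. exact: (xgetPex _ (direction_exists A)). Qed.

Lemma sub_direction A x y : A x -> A y -> x - y \in direction A.
Proof. by case: (direction_spec A) => + _; apply. Qed.

Lemma direction_min A (W : {vspace 'rV[R]_n}) :
  (forall x y, A x -> A y -> x - y \in W) -> (direction A <= W)%VS.
Proof. by case: (direction_spec A) => _; apply. Qed.

Lemma direction_minl A x (W : {vspace 'rV[R]_n}) :
  (forall y, A y -> y - x \in W) -> (direction A <= W)%VS.
Proof.
move=> AW; apply: direction_min => y z Ay Az.
have -> : y - z = (y - x) - (z - x) by rewrite opprB addrA subrK.
by rewrite rpredB ?AW.
Qed.

Lemma direction_dot0 A c b : A `<=` [set x | dot c x = b] ->
  forall u, u \in direction A -> dot c u = 0.
Proof.
move=> Ab u uA.
have /subvP/(_ u uA) : (direction A <= lker (linfun (dot c : _ -> R^o)))%VS.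
  apply: direction_min => x y Ax Ay.
  by rewrite memv_ker lfunE /= dotBr !Ab // subrr.
by rewrite memv_ker lfunE => /eqP.
Qed.

Lemma affdim_nonempty A x : A x -> affdim A = (\dim (direction A))%:Z.
Proof.
by move=> Ax; rewrite /affdim ifF //; apply/asboolP => A0; rewrite A0 in Ax.
Qed.

(** * Faces of the convex hull of finitely many points *)

Section ConvexHull.
Variables (m : nat) (p : 'I_m -> 'rV[R]_n).
Let P := convex_hull p.

Lemma convex_hull_generator i : P (p i).
Proof.
exists (fun j => (j == i)%:R); split=> [j||]; first exact: ler0n.
- by rewrite (bigD1 i) //= eqxx big1 ?addr0 // => j /negbTE ->.
- rewrite (bigD1 i) //= eqxx scale1r big1 ?addr0 // => j /negbTE ->.
  by rewrite scale0r.
Qed.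

Lemma convex_hull_le c b : (forall i, dot c (p i) <= b) ->
  forall x, P x -> dot c x <= b.
Proof.
move=> cb x [l [l0 l1 ->]]; rewrite dot_combination -[b]mul1r -l1 mulr_suml.
by apply: ler_sum => i _; exact: ler_wpM2l.
Qed.

Lemma exposed_face c b : (forall i, dot c (p i) <= b) ->
  face P (P `&` [set x | dot c x = b]).
Proof. by move=> cb; exists c, b; split=> //; exact: convex_hull_le. Qed.

(** In a convex combination lying on [F], the weighted slacks of the generators are nonnegative and
    sum to zero. So every generator of nonzero weight lies on [F]. *)
Lemma face_dot_const F c b : face P F ->
  (forall i, F (p i) -> dot c (p i) = b) -> forall x, F x -> dot c x = b.
Proof.
move=> [d [e [de ->]]] FG _ [[l [l0 l1 ->]]] /= dx.
have l_eq0 i : l i * (e - dot d (p i)) = 0.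
  have /psumr_eq0P -> // : \sum_i l i * (e - dot d (p i)) = 0.
    under eq_bigr do rewrite mulrBr.
    by rewrite sumrB -mulr_suml l1 mul1r -dot_combination dx subrr.
  by move=> j _; rewrite mulr_ge0 // subr_ge0 de //; exact: convex_hull_generator.
rewrite dot_combination -[b]mul1r -l1 mulr_suml; apply: eq_bigr => i _.
have /eqP := l_eq0 i; rewrite mulf_eq0 => /orP[/eqP ->|]; first by rewrite !mul0r.
by rewrite subr_eq0 => /eqP dp; rewrite FG //; split=> //; exact: convex_hull_generator.
Qed.

Lemma face_sub F : face P F -> F `<=` P.
Proof. by move=> [c [b [_ ->]]] x []. Qed.

Lemma face_subP F G : face P F -> face P G ->
  (forall i, F (p i) -> G (p i)) -> F `<=` G.
Proof.
move=> fF [c [b [cb ->]]] FG x Fx; split; first exact: face_sub F fF _ Fx.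
by apply: (face_dot_const F c b) Fx => // i /FG[].
Qed.

Lemma face_generator F x : face P F -> F x -> exists i, F (p i).
Proof.
move=> fF Fx; apply: contrapT => nF.
(* Without generators in [F], [face_dot_const] applies vacuously, even to the absurd equation
   [0 = 1]. *)
have F1 y : F y -> dot 0 y = 1.
  by apply: face_dot_const y => // i Fi; case: nF; exists i.
by have := F1 x Fx; rewrite dot0l => /esym/eqP; rewrite oner_eq0.
Qed.

(** A face of a face is a face: for [N] large, the slack of [c] off [F] outweighs any gain in [d],
    so [N *: c + d] is maximal exactly at the generators of [F] that maximise [d]. *)
Lemma face_refine F d i0 : face P F -> F (p i0) ->
  (forall i, F (p i) -> dot d (p i) <= dot d (p i0)) ->
  exists2 K, face P K &
    forall i, K (p i) <-> F (p i) /\ dot d (p i) = dot d (p i0).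
Proof.
move=> [c [b [cb ->]]] [_ /= ci0] dmax.
pose y i := b - dot c (p i); pose z i := dot d (p i0) - dot d (p i).
have y0 i : 0 <= y i by rewrite subr_ge0 cb //; exact: convex_hull_generator.
(* [N] exceeds each ratio [|z i| / y i] with [y i != 0]; the terms with [y i = 0] are zero by the
   convention on inverses. *)
pose N := 1 + \sum_i `|z i| / y i.
have Nyz i : y i != 0 -> 0 < N * y i + z i.
  move=> yi; have yi0 : 0 < y i by rewrite lt_def yi y0.
  have : `|z i| / y i < N.
    rewrite /N (bigD1 i) //= addrCA ltrDl ltr_wpDr // sumr_ge0 // => j _.
    by rewrite divr_ge0.
  rewrite ltr_pdivrMr // => ltz; rewrite -ltrBlDr sub0r.
  by apply: le_lt_trans ltz; rewrite -normrN ler_norm.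
have z0 i : y i = 0 -> 0 <= z i.
  move=> /subr0_eq yi; rewrite subr_ge0 dmax //; split=> //.
  exact: convex_hull_generator.
have E i : N * b + dot d (p i0) - dot (N *: c + d) (p i) = N * y i + z i.
  by rewrite dotDl dotZl /y /z mulrBr opprD addrACA.
exists (P `&` [set x | dot (N *: c + d) x = N * b + dot d (p i0)]).
  apply: exposed_face => i; rewrite -subr_ge0 E.
  have [yi|/Nyz/ltW//] := eqVneq (y i) 0.
  by rewrite yi mulr0 add0r z0.
move=> i; split=> [[_ /= Ki]|[[_ /= ci] di]].
  have /eqP := E i; rewrite Ki subrr eq_sym.
  have [yi|/Nyz/gt_eqF->//] := eqVneq (y i) 0.
  rewrite yi mulr0 add0r subr_eq0 => /eqP zi; split=> //.
  by split; [exact: convex_hull_generator|rewrite /= (subr0_eq yi)].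
split; first exact: convex_hull_generator.
by rewrite /= dotDl dotZl ci di.
Qed.

Lemma face_refine_max F d i : face P F -> F (p i) ->
  exists2 i0, F (p i0) & exists2 K, face P K &
    [/\ forall i, K (p i) <-> F (p i) /\ dot d (p i) = dot d (p i0)
      & forall i, F (p i) -> dot d (p i) <= dot d (p i0)].
Proof.
move=> fF Fi.
have Pi : [pred i | `[< F (p i) >]] i by apply/asboolP.
case: (Order.TotalTheory.arg_maxP (fun i => dot d (p i)) Pi) => i0 /asboolP Fi0 imax.
have {}imax j : F (p j) -> dot d (p j) <= dot d (p i0).
  by move=> Fj; apply: imax; apply/asboolP.
exists i0 => //; have [K fK KE] := face_refine F d i0 fF Fi0 imax.
by exists K.
Qed.

(** * Vertices of faces *)

Definition generators F : {set 'I_m} := [set i | `[< F (p i) >]]%SET.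

Lemma generatorsP F i : reflect (F (p i)) (i \in generators F).
Proof. by rewrite inE; exact: asboolP. Qed.

(** Induction on the number of generators in the face. If two of them differ in some coordinate, the
    subface maximising that coordinate has fewer generators; if all coincide, the face is a
    point. *)
Lemma face_has_vertex F i : face P F -> F (p i) ->
  exists2 v, face P [set v] & F v.
Proof.
have [k] := ubnP #|generators F|; elim: k F i => // k IH F i ltk fF Fi.
have [eqF|] := pselect (forall j, F (p j) -> p j = p i).
  exists (p i) => //; suff -> : [set p i] = F by [].
  apply/seteqP; split=> [_ ->//|x Fx]; apply/rowP => j; rewrite -!dot_delta.
  by apply: (face_dot_const F) Fx => // i' /eqF ->.
move=> /existsNP[j] /not_implyP[Fj /eqP]; rewrite eq_sym => /eqP ji.
have /existsNP[k' /eqP neq_k] : ~ forall k', p i 0 k' = p j 0 k'.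
  by move=> eq_k; apply: ji; apply/rowP.
have [i0 Fi0 [K fK [KE _]]] := face_refine_max F (delta_mx 0 k') i fF Fi.
have KF : K `<=` F by apply: face_subP => // l /KE[].
have [v fv Kv] : exists2 v, face P [set v] & K v.
  apply: (IH K i0) => //; last by apply/KE.
  rewrite ltnS in ltk; apply: leq_trans ltk; apply: proper_card; apply/properP; split.
    by apply/fintype.subsetP => l /generatorsP/KF Fl; apply/generatorsP.
  (* The subface loses [p j] if [p i] attains the maximum, and [p i] otherwise. *)
  have [ei|ni] := eqVneq (p i 0 k') (p i0 0 k').
    exists j; first exact/generatorsP.
    apply/generatorsP => /KE[_]; rewrite !dot_delta -ei => /esym/eqP.
    by rewrite (negbTE neq_k).
  exists i; first exact/generatorsP.
  by apply/generatorsP => /KE[_]; rewrite !dot_delta => /eqP; rewrite (negbTE ni).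
by exists v => //; exact: KF.
Qed.

(** Since [p i] lies strictly below the hyperplane of [H], so does the whole subface of [F] on which
    the functional of [H] is minimal. Any vertex of that subface serves. *)
Lemma vertex_outside F H i : face P F -> face P H -> F (p i) -> ~ H (p i) ->
  exists v, [/\ face P [set v], F v & ~ H v].
Proof.
move=> fF fH Fi nHi; have [c [b [cb eH]]] := fH.
have [i0 Fi0 [K fK [KE Kmax]]] := face_refine_max F (- c) i fF Fi.
have Ki0 : K (p i0) by apply/KE.
have [v fv Kv] := face_has_vertex K i0 fK Ki0.
exists v; split=> //; first by apply: (face_subP K F) Kv => // j /KE[].
rewrite eH => -[_ /= cv].
have : dot (- c) v = dot (- c) (p i0).
  by apply: (face_dot_const K) Kv => // j /KE[].
rewrite !dotNl cv => /oppr_inj ci0.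
apply: nHi; rewrite eH; split; first exact: convex_hull_generator.
apply/le_anti; rewrite cb /=; last exact: convex_hull_generator.
by have := Kmax i Fi; rewrite !dotNl lerN2 ci0.
Qed.

(* The supporting hyperplane of [H] is rotated by the affine functional
   [dot d x - a], which vanishes on [H], until it meets a further generator. *)
Lemma face_rotate H d a j : face P H -> (forall i, H (p i) -> dot d (p i) = a) ->
  dot d (p j) != a ->
  exists2 K, face P K & [/\ forall i, H (p i) -> K (p i),
    forall i, dot d (p i) = a -> K (p i) -> H (p i)
    & exists2 k, K (p k) & ~ H (p k)].
Proof.
(* Replacing [d] and [a] by their opposites preserves the hypotheses and the conclusion. *)
wlog ltj : d a / a < dot d (p j).
  move=> IH fH Hd; rewrite neq_lt => /orP[] lt_j;
    last by apply: (IH d a) => //; rewrite gt_eqF.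
  have [|||K fK [HK KH ex]] := IH (- d) (- a) _ fH.
  - by rewrite dotNl ltrN2.
  - by move=> i /Hd; rewrite dotNl => ->.
  - by rewrite dotNl eqr_opp lt_eqF.
  exists K => //; split=> // i di; apply: KH.
  by rewrite dotNl di.
move=> [c [b [cb eH]]] Hd _.
have Pp := convex_hull_generator.
pose y i := b - dot c (p i); pose z i := dot d (p i) - a.
have y0 i : 0 <= y i by rewrite subr_ge0 cb.
have Pj : [pred i | 0 < z i] j by rewrite /= subr_gt0.
case: (Order.TotalTheory.arg_minP (fun i => y i / z i) Pj) => k /= zk kmin.
(* The rotated inequality at [p i] reads [t * z i <= y i]. The least ratio is the largest admissible
   [t], and equality at [k] puts [p k] on the new face. *)
pose t := y k / z k.
have t0 : 0 <= t by rewrite divr_ge0 // ltW.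
have E i : b + t * a - dot (c + t *: d) (p i) = y i - t * z i.
  by rewrite dotDl dotZl mulrBr opprB opprD addrACA.
exists (P `&` [set x | dot (c + t *: d) x = b + t * a]).
  apply: exposed_face => i; rewrite -subr_ge0 E.
  have [zi|zi] := ltP 0 (z i); first by rewrite subr_ge0 -ler_pdivlMr // kmin.
  by rewrite addr_ge0 // oppr_ge0 mulr_ge0_le0.
rewrite eH in Hd *; split=> [i Hi|i di [_ /= Ki]|].
- split=> //=; have [_ /= ci] := Hi.
  by rewrite dotDl dotZl ci (Hd i Hi).
- split=> //=; apply/esym/subr0_eq.
  by have := E i; rewrite Ki /z di !subrr mulr0 subr0.
exists k.
  split=> //=; apply/esym/subr0_eq.
  by rewrite E /t divfK ?subrr // gt_eqF.
by move=> /Hd dk; move: zk; rewrite /z dk subrr ltxx.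
Qed.

(** * Facets as maximal faces avoiding a generator *)

Lemma convex_hull_translate x y (W : {vspace 'rV[R]_n}) :
  (forall i, p i - x \in W) -> P y -> y - x \in W.
Proof.
move=> Wp [l [l0 l1 ->]]; rewrite -[x]scale1r -l1 scaler_suml -sumrB.
by apply: memv_suml => i _; rewrite -scalerBr memvZ.
Qed.

(** Maximality forces [H] and [x] together to span the affine hull of [P], so adding the single
    point [x] outside the hull of [H] raises the dimension by exactly one. *)
Lemma maximal_face_facet H i0 : 1 <= affdim P -> face P H -> ~ H (p i0) ->
  (forall K, face P K -> ~ K (p i0) -> (forall i, H (p i) -> K (p i)) ->
     forall i, K (p i) -> H (p i)) ->
  facets P H.
Proof.
move=> hdim fH nHx Hmax; split=> //.
have Pp := convex_hull_generator.
set x := p i0 in nHx Hmax *; have Px : P x by exact: Pp.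
rewrite (affdim_nonempty P x Px) in hdim *.
set D := direction P in hdim *; set V := direction (H `|` [set x]).
have DV : (D <= V)%VS.
  apply: (direction_minl P x) => y; apply: convex_hull_translate => j.
  (* Otherwise some functional is constant on [H] and [x] but takes another value at [p j]. Rotating
     along it yields a strictly larger face, which still avoids [x] because [x] is on the axis of
     rotation. *)
  apply: contraT => pjV.
  have [d [dV dj]] := separating_functional V (p j - x) pjV.
  have dH i : H (p i) -> dot d (p i) = dot d x.
    move=> Hi; apply/subr0_eq; rewrite -dotBr dV // sub_direction //; first by left.
    by right.
  have djx : dot d (p j) != dot d x by rewrite -subr_eq0 -dotBr.
  have [K fK [HK KH [k Kk nHk]]] := face_rotate H d (dot d x) j fH dH djx.
  by case: nHk; apply: (Hmax K) => // Kx; apply: nHx; apply: KH.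
(* For empty [H], [V] is the direction of one point, so [D] would be zero, against [hdim]. *)
have [h Hh] : exists h, H h.
  apply: contrapT => H0; have : (D <= 0)%VS.
    apply: subv_trans DV _; apply: (direction_minl _ x) => y [Hy|->].
      by case: H0; exists y.
    by rewrite subrr mem0v.
  by rewrite subv0 => /eqP D0; rewrite D0 dimv0 in hdim.
rewrite (affdim_nonempty H h) //; set U := direction H.
have [c [b [_ eH]]] := fH.
have UD : (U <= D)%VS.
  apply: direction_min => y z Hy Hz.
  by apply: sub_direction; apply: (face_sub H).
(* The functional defining [H] vanishes on [U] but separates [h] from [x]. *)
have hxU : h - x \notin U.
  have Hb : H `<=` [set y | dot c y = b] by rewrite eH => y [].
  apply/negP => /(direction_dot0 H c b Hb); rewrite dotBr (Hb h Hh) => /subr0_eq cx.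
  by apply: nHx; rewrite eH; split=> //=; rewrite cx.
have ltUD : (\dim U < \dim D)%N.
  rewrite (ltn_leqif (dimv_leqif_eq UD)); apply: contra hxU => /eqP ->.
  by apply: sub_direction => //; apply: (face_sub H).
have leDU : (\dim D <= (\dim U).+1)%N.
  have /dimvS : (D <= U + <[h - x]>)%VS.
    apply: subv_trans DV _; apply: (direction_minl _ h) => y [Hy|->].
      by rewrite (subvP (addvSl _ _)) // sub_direction.
    by rewrite -opprB rpredN (subvP (addvSr _ _)) // memv_line.
  move/leq_trans; apply; apply: leq_trans (dimv_add_leqif _ _).1 _.
  by rewrite dim_vline; case: (_ != _); rewrite ?addn1 ?addn0.
have -> : \dim D = (\dim U).+1 by apply/eqP; rewrite eqn_leq leDU.
by rewrite intS [1 + _]addrC addrK.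
Qed.

(** Generator sets are subsets of a finite set, so a face with the most generators exists among
    those containing the generators of [G] and avoiding [p i0]; it is maximal. *)
Lemma facet_avoiding G i0 : 1 <= affdim P -> face P G -> ~ G (p i0) ->
  exists H, [/\ facets P H, forall i, G (p i) -> H (p i) & ~ H (p i0)].
Proof.
move=> hdim fG nGx.
pose good (T : {set 'I_m}) := `[< exists H, [/\ face P H,
  forall i, G (p i) -> H (p i), ~ H (p i0) & T = generators H] >].
have goodG : good (generators G) by apply/asboolP; exists G.
case: (arg_maxnP (fun T : {set 'I_m} => #|T|) goodG).
move=> T /asboolP[H [fH GH nHx ->]] Tmax.
exists H; split=> //; apply: (maximal_face_facet H i0) => // K fK nKx HK i Ki.
have sHK : generators H \subset generators K.
  by apply/fintype.subsetP => j /generatorsP/HK Kj; apply/generatorsP.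
have /eqP eHK : generators H == generators K.
  rewrite eqEcard sHK /=; apply: Tmax; apply/asboolP.
  by exists K; split=> // j /GH/HK.
by apply/generatorsP; rewrite eHK; apply/generatorsP.
Qed.

Lemma convex_hull_facet_vertex_separation F G : 1 <= affdim P ->
  face P F -> face P G ->
  ~ F `<=` G -> exists H v,
  [/\ facets P H, face P [set v], G `<=` H, F v & ~ H v].
Proof.
move=> hdim fF fG nFG.
have [i /not_implyP[Fi nGi]] : exists i, ~ (F (p i) -> G (p i)).
  by apply/existsNP => FG; apply: nFG; apply: face_subP.
have [H [[fH dH] GH nHi]] := facet_avoiding G i hdim fG nGi.
have [v [fv Fv nHv]] := vertex_outside F H i fF fH Fi nHi.
by exists H, v; split=> //; apply: face_subP.
Qed.

Lemma finite_vertices : finite_set (vertices P).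
Proof.
apply: (@sub_finite_set _ _ (range p)); last exact: finite_image.
move=> v fv; have [i <-] := face_generator [set v] v fv erefl.
by exists i.
Qed.

End ConvexHull.
End Geometry.

(** * Rectangle coverings as indexed families *)

Section RectangleCovering.
Local Open Scope card_scope.
Variables (R : realType) (I J : Type) (M : I -> J -> R).

(** A family may repeat rectangles or contain empty ones, so this property is monotone in [r],
    unlike having a covering with exactly [r] elements. *)
Definition covered_by_rectangles (r : nat) : Prop :=
  exists (A : 'I_r -> set I) (B : 'I_r -> set J),
    forall i j, M i j != 0 <-> exists k, A k i /\ B k j.

Lemma rectangle_covering_indexed C r :
  rectangle_covering M C -> C #= `I_r -> covered_by_rectangles r.
Proof.
move=> [rectC covC] /card_esym/card_set_bijP[f [fC _ fsurj]].
have /choice[AB fAB] (k : 'I_r) : exists AB : set I * set J, f k = AB.1 `*` AB.2.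
  have /rectC[[A [B ->]] _] : C (f k) by apply: fC; exact: ltn_ord.
  by exists (A, B).
exists (fst \o AB), (snd \o AB) => i j; have <- : supp M (i, j) = (M i j != 0) by [].
rewrite -covC; split=> [[Q /fsurj[k kr <-]]|[k ABk]].
  by rewrite (fAB (Ordinal kr)) => -[Ai Bj]; exists (Ordinal kr).
by exists (f k); [apply: fC; exact: ltn_ord|rewrite fAB].
Qed.

(** Distinct indices may carry the same rectangle, whence a size [s] that is possibly smaller than
    [r]. *)
Lemma indexed_rectangle_covering r : covered_by_rectangles r ->
  exists2 s, (s <= r)%N & exists C, rectangle_covering M C /\ C #= `I_s.
Proof.
move=> [A [B AB]]; pose Q (k : 'I_r) := A k `*` B k.
have leC : range Q #<= `I_r.
  apply: card_le_trans (card_image_le Q setT) _.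
  have val_inj' : {in [set: 'I_r] &, injective (@nat_of_ord r)}.
    by move=> ? ? _ _; exact: val_inj.
  rewrite -(card_le_eql (inj_card_eq val_inj')).
  by apply: subset_card_le => _ [k _ <-]; exact: ltn_ord.
have /finite_setP[s Cs] : finite_set (range Q).
  exact: card_le_finite leC (finite_II r).
exists s; first by rewrite -card_le_II -(card_le_eql Cs).
exists (range Q); split=> //; split=> [_ [k _ <-]|].
  split; first by exists (A k), (B k).
  by move=> [i j] [Ai Bj]; apply/AB; exists k.
apply/seteqP; split=> [[i j] [_ [k _ <-]] [Ai Bj]|[i j] /AB[k [Ai Bj]]].
  by apply/AB; exists k.
by exists (Q k).
Qed.

(** The hypothesis supplies a finite covering, so [xget] returns a true minimum instead of the
    default 0. Passing between sets and families does not change that minimum. *)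
Lemma rc_is_least r : covered_by_rectangles r ->
  is_least [set r | covered_by_rectangles r] (rc M).
Proof.
move=> /indexed_rectangle_covering[s _ Cs].
pose S := [set r | exists C, rectangle_covering M C /\ C #= `I_r].
have [lC lmin] : is_least S (rc M).
  apply: xgetPex.
  have ex : exists r, `[< S r >] by exists s; exact/asboolP.
  case: (ex_minnP ex) => l /asboolP Sl lmin; exists l; split=> // k Sk.
  by apply: lmin; exact/asboolP.
split; first by have [C [covC Cl]] := lC; exact: rectangle_covering_indexed Cl.
move=> k /indexed_rectangle_covering[t tk Ct].
by apply: leq_trans tk; apply: lmin.
Qed.

End RectangleCovering.

Arguments covered_by_rectangles {R I J} M r.

(** * Coverings and embeddings of the face lattice *)

Section FaceLattice.
Variables (R : realType) (n : nat) (P : set 'rV[R]_n).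
Hypotheses (hP : polytope P) (hdim : 1 <= affdim P).
Let M := @nonincidence R n P.

Lemma facet_vertex_separation F G : face P F -> face P G ->
  ~ F `<=` G -> exists H v,
  [/\ facets P H, face P [set v], G `<=` H, F v & ~ H v].
Proof.
have [m [p eP]] := hP; have := hdim; rewrite eP.
exact: convex_hull_facet_vertex_separation.
Qed.

Lemma nonincidenceP (F : facets P) (v : vertices P) :
  M F v != 0 <-> ~ \val F (\val v).
Proof.
rewrite /M /nonincidence pnatr_eq0 eqb0 negbK; split.
  by move=> vF /mem_set; rewrite (negbTE vF).
by move=> vF; apply/negP => /set_mem.
Qed.

Lemma face_set0 : face P set0.
Proof.
exists 0, 1; split=> [x _|]; first by rewrite dot0l.
by apply/seteqP; split=> // x [_ /=]; rewrite dot0l => /esym/eqP; rewrite oner_eq0.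
Qed.

Lemma face_self : face P P.
Proof.
exists 0, 0; split=> [x _|]; first by rewrite dot0l.
by apply/seteqP; split=> [x Px|x []//]; split=> //=; rewrite dot0l.
Qed.

(** The support is the union of its columns, one rectangle for each of the finitely many
    vertices. *)
Lemma covered_by_rectangles_vertices : exists r, covered_by_rectangles M r.
Proof.
have /finite_seqP[s eqs] : finite_set (vertices P).
  by have [m [p ->]] := hP; exact: finite_vertices.
exists (size s), (fun k => [set F : facets P | ~ \val F s`_k]),
  (fun k => [set v : vertices P | \val v = s`_k]) => F v.
rewrite nonincidenceP; split=> [vF|[k [/= + ->]]//].
have vs : \val v \in s by have := set_mem (valP v); rewrite {1}eqs.
have ks : (index (\val v) s < size s)%N by rewrite index_mem.
by exists (Ordinal ks); rewrite /= nth_index.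
Qed.

Lemma embeds_of_covered r : covered_by_rectangles M r -> face_lattice_embeds P r.
Proof.
move=> [A [B AB]].
pose f F : {set 'I_r} :=
  [set k | `[< exists2 v : vertices P, B k v & F (\val v) >]]%SET.
exists f => F G fF fG; split=> [FG|sub].
  apply/fintype.subsetP => k; rewrite !inE => -[v Bv Fv].
  by exists v => //; exact: FG.
apply: contrapT => nFG.
have [H [v [fH fv GH Fv nHv]]] := facet_vertex_separation F G fF fG nFG.
pose H' : facets P := exist _ H (mem_set fH).
pose v' : vertices P := exist _ v (mem_set fv).
(* The index [k] of a rectangle through [(H, v)] lies in [f F], hence in [f G]. So [G] has a vertex
   [w] in [B k], and [(H, w)] is non-incident although [G] is contained in [H]. *)
have /AB[k [Ak Bk]] : M H' v' != 0 by apply/nonincidenceP.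
have : k \in f G.
  by apply: (fintype.subsetP sub); rewrite !inE; exists v'.
rewrite !inE => -[w Bw Gw].
have /nonincidenceP : M H' w != 0 by apply/AB; exists k.
by apply; exact: GH.
Qed.

(** A vertex lies on a facet exactly when the face [[set v]] is below it, so non-incidence means
    that some [k] belongs to the image of the vertex and not to that of the facet. *)
Lemma covered_of_embeds r : face_lattice_embeds P r -> covered_by_rectangles M r.
Proof.
move=> [f fE].
exists (fun k => [set F : facets P | k \notin f (\val F)]),
  (fun k => [set v : vertices P | k \in f [set \val v]]) => F v.
have fF : faces P (\val F) by case: (set_mem (valP F)).
have fv : faces P [set \val v] := set_mem (valP v).
rewrite nonincidenceP; split=> [vF|[k [/= kF kv]] Fv].
  have /negP/subsetPn[k kv kF] : ~ f [set \val v] \subset f (\val F).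
    by move=> /(fE _ _ fv fF) sub; apply: vF; exact: sub.
  by exists k.
have /fintype.subsetP/(_ k kv) : f [set \val v] \subset f (\val F).
  by apply/(fE _ _ fv fF) => _ ->.
by rewrite (negbTE kF).
Qed.

(** Separating [P] from the empty face produces a nonzero entry, which some rectangle must cover. *)
Lemma covered_gt0 r : covered_by_rectangles M r -> (0 < r)%N.
Proof.
have [H [v [fH fv _ _ nHv]]] : exists H v,
    [/\ facets P H, face P [set v], set0 `<=` H, P v & ~ H v].
  apply: facet_vertex_separation; [exact: face_self|exact: face_set0|].
  by move=> P0; move: hdim; rewrite /affdim ifT //; apply/asboolP; rewrite -subset0.
pose H' : facets P := exist _ H (mem_set fH).
pose v' : vertices P := exist _ v (mem_set fv).
move=> [A [B AB]]; have /AB[k _] : M H' v' != 0 by apply/nonincidenceP.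
exact: leq_ltn_trans (ltn_ord k).
Qed.

End FaceLattice.

Theorem theorem2p12 (R : realType) (n : nat) (P : set 'rV[R]_n)
    (hP : polytope P) (hdim : 1 <= affdim P) :
  is_least [set r : nat | (1 <= r)%N /\ face_lattice_embeds P r]
    (rc_polytope P).
Proof.
have [r0 cov0] := covered_by_rectangles_vertices R n P hP.
have [cov least] := rc_is_least R _ _ _ r0 cov0.
split=> [|r [_ emb]]; last by apply: least; exact: covered_of_embeds.
by split; [exact: covered_gt0 cov|exact: embeds_of_covered].
Qed.
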